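(* Let $n,\lambda,\mu,\nu$ be nonnegative integers with $\lambda>1+\mu+\nu$. Then \[\sum_{k=0}^n \frac{\binom{n}{k}\binom{\lambda n+k}{k}\binom{\mu n+n}{k}}{\binom{\nu n+k}{k}\binom{(\lambda-\mu-\nu-2)n+k}{k}}\Big\{H_{\lambda n+k}-H_{(\lambda-\mu-\nu-2)n+k}\Big\} = \frac{\binom{(\lambda-\nu)n}{n}\binom{(\mu+\nu+2)n}{n}}{\binom{\nu n+n}{n}\binom{(\lambda-\mu-\nu-1)n}{n}}\Big\{H_{(\lambda-\nu)n}-H_{(\lambda-\nu-1)n}+H_{\lambda n}-H_{(\lambda-\mu-\nu-1)n}\Big\}.\]
   Context: $H_0=0$ and $H_m=\sum_{j=1}^m \frac{1}{j}$ for positive integers $m$ (classical harmonic numbers). *)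

(* Defs.v *)
From mathcomp Require Import all_boot all_order all_algebra.
Set Implicit Arguments.
Unset Strict Implicit.
Unset Printing Implicit Defensive.
Import GRing.Theory.
Local Open Scope ring_scope.

Definition harmonic_number (m : nat) : rat :=
  \sum_(1 <= j < m.+1) (j%:R : rat)^-1.

(* Main.v *)
(** The sum without the harmonic factor is a terminating balanced 3F2, summed by
    the Pfaff-Saalschütz theorem. Cleared of denominators, that theorem is an
    identity valid in every commutative ring; it is applied in rat[X] with
    lam * n replaced by lam * n + X, and the harmonic numbers appear as
    logarithmic derivatives of the factorials at X = 0. *)
Require Import Defs.
From mathcomp Require Import all_boot all_order all_algebra.
From mathcomp Require Import ring zify.
Import GRing.Theory.
Local Open Scope ring_scope.

Definition rising {R : comNzRingType} (x : R) (m : nat) : R :=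
  \prod_(i < m) (x + i%:R).

Definition falling {R : comNzRingType} (x : R) (m : nat) : R :=
  \prod_(i < m) (x - i%:R).

Lemma rising0 (R : comNzRingType) (x : R) : rising x 0 = 1.
Proof. exact: big_ord0. Qed.

Lemma falling0 (R : comNzRingType) (x : R) : falling x 0 = 1.
Proof. exact: big_ord0. Qed.

Lemma risingS (R : comNzRingType) (x : R) m :
  rising x m.+1 = rising x m * (x + m%:R).
Proof. exact: big_ord_recr. Qed.

Lemma risingSl (R : comNzRingType) (x : R) m :
  rising x m.+1 = x * rising (x + 1) m.
Proof.
rewrite /rising big_ord_recl addr0; congr (_ * _).
by apply: eq_bigr => i _; rewrite lift0 -addrA nat1r.
Qed.

Lemma fallingS (R : comNzRingType) (x : R) m :
  falling x m.+1 = falling x m * (x - m%:R).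
Proof. exact: big_ord_recr. Qed.

(** Both products run over [x + 1], ..., [x + m], in opposite orders. *)
Lemma falling_rising (R : comNzRingType) (x : R) m :
  falling (x + m%:R) m = rising (x + 1) m.
Proof.
rewrite /falling (reindex_inj rev_ord_inj); apply: eq_bigr => i _ /=.
by rewrite natrB //; ring.
Qed.

Lemma falling_nat (R : comNzRingType) (N m : nat) :
  falling N%:R m = (N ^_ m)%:R :> R.
Proof.
elim: m => [|m IHm]; first by rewrite falling0 ffactn0.
rewrite fallingS IHm ffactnSr natrM.
have [leNm|lt_Nm] := leqP m N; first by rewrite natrB.
(* Here the truncated [N - m] differs from the difference in [R], but [N ^_ m] is already 0. *)
by rewrite ffact_small ?mul0r.
Qed.

Lemma rising_nat (R : comNzRingType) (N m : nat) :
  rising N.+1%:R m = ((N + m) ^_ m)%:R :> R.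
Proof. by rewrite -falling_nat natrD falling_rising natr1. Qed.

(* The summand of 3F2(-n, a, -b; c, 1 + a - b - c - n; 1), multiplied by the
   Pochhammer symbols of order n of the two lower parameters; falling
   factorials absorb all the signs. *)
Definition saalschutz_term {R : comNzRingType} (a b c : R) (n k : nat) : R :=
  'C(n, k)%:R * (rising a k * falling b k
    * rising (c + k%:R) (n - k) * falling (a - c - b) (n - k)).

(* The recurrence in n found by Zeilberger's algorithm, summed over k <= m: the
   last term is what remains of the telescoping certificate. *)
Lemma saalschutz_partial (R : comNzRingType) (a b c : R) (n m : nat) :
  (m <= n)%N ->
  \sum_(k < m.+1) saalschutz_term a b c n.+1 k =
    (a - c - n%:R) * (c + b + n%:R) * \sum_(k < m.+1) saalschutz_term a b c n k
    - saalschutz_term a b c n m * ((a + m%:R) * (b - m%:R)).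
Proof.
elim: m => [_|m IHm ltmn].
  rewrite !big_ord_recr !big_ord0 /= /saalschutz_term !bin0 !subn0.
  by rewrite !rising0 !falling0 risingS fallingS; ring.
rewrite big_ord_recr [in RHS]big_ord_recr /= (IHm (ltnW ltmn)) /saalschutz_term.
have [q ->] : exists q, n = (m.+1 + q)%N by exists (n - m.+1)%N; lia.
have -> : ((m.+1 + q).+1 - m.+1 = q.+1)%N by lia.
have -> : (m.+1 + q - m = q.+1)%N by lia.
have -> : (m.+1 + q - m.+1 = q)%N by lia.
(* Besides Pascal's rule, this ratio of neighbouring binomials is the only arithmetic input; the two
   sides will differ by a multiple of it. *)
have := mul_bin_left (m.+1 + q) m; have -> : (m.+1 + q - m = q.+1)%N by lia.
move/(congr1 (fun i => i%:R : R)); rewrite !natrM => binE.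
rewrite binS (natrD _ 'C(_, _)) (risingSl _ (c + m%:R)) -[c + _ + 1]addrA natr1 (risingS _ (c + _)).
rewrite !(risingS _ a) !(fallingS _ b) (fallingS _ (a - c - b)).
set S := \sum_(_ < _) _; set P := rising (c + m.+1%:R) q.
set Q := falling (a - c - b) q; set A := rising a m; set F := falling b m.
move: S P Q A F binE; set C0 := 'C(_, m)%:R; set C1 := 'C(_, m.+1)%:R.
move: C0 C1 => C0 C1 S P Q A F binE.
apply/subr0_eq; transitivity (A * F * P * Q * (a + m%:R) * (b - m%:R)
    * (a - c - b - q%:R) * (q.+1%:R * C0 - m.+1%:R * C1)); first by ring.
by rewrite binE subrr mulr0.
Qed.

(** Induction on [n]: at [m = n] the remainder of the telescoping cancels the top term [k = n + 1],
    leaving the first-order recurrence that the right-hand side satisfies. *)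
Lemma saalschutz (R : comNzRingType) (a b c : R) (n : nat) :
  \sum_(k < n.+1) saalschutz_term a b c n k = falling (a - c) n * rising (c + b) n.
Proof.
elim: n => [|n IHn].
  rewrite big_ord_recr big_ord0 /= /saalschutz_term bin0 !rising0 !falling0.
  by ring.
rewrite big_ord_recr /= saalschutz_partial // IHn /saalschutz_term !subnn !binn.
by rewrite !rising0 !falling0 !risingS !fallingS; ring.
Qed.

(* A product of jets multiplies the values and adds the logarithmic
   derivatives, without any nonvanishing condition. *)
Definition log_jet (p : {poly rat}) (v l : rat) : Prop :=
  p.[0] = v /\ p^`().[0] = v * l.

Lemma log_jetC (v : rat) : log_jet v%:P v 0.
Proof. by split; rewrite ?derivC hornerC ?mulr0. Qed.

Lemma log_jetM (p q : {poly rat}) (v l w m : rat) :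
  log_jet p v l -> log_jet q w m -> log_jet (p * q) (v * w) (l + m).
Proof.
move=> [pv pl] [qw qm]; split; first by rewrite hornerM pv qw.
by rewrite derivM hornerD !hornerM pv pl qw qm; ring.
Qed.

Lemma harmonic_numberS (N : nat) :
  harmonic_number N.+1 = harmonic_number N + N.+1%:R^-1.
Proof. by rewrite /harmonic_number big_nat_recr. Qed.

(** Each factor [j + 'X] with [N < j <= N + m] contributes the logarithmic derivative [1 / j] at
    0. *)
Lemma log_jet_rising (N m : nat) :
  log_jet (rising (N.+1%:R + 'X) m) ((N + m) ^_ m)%:R
    (harmonic_number (N + m) - harmonic_number N).
Proof.
elim: m => [|m IHm].
  rewrite addn0 subrr rising0; exact: log_jetC.
have /(log_jetM _ _ _ _ _ _ IHm) : log_jet (N.+1%:R + 'X + m%:R)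
    (N + m).+1%:R ((N + m).+1%:R^-1).
  split; last first.
    rewrite mulfV ?Num.Theory.pnatr_eq0 //.
    by rewrite !derivE !mul0rn !hornerE.
  by rewrite -!polyC_natr !hornerE -natrD addSn.
by rewrite risingS addnS ffactSS harmonic_numberS mulnC natrM [_ + _^-1 - _]addrAC.
Qed.

Lemma log_jet_falling (N m : nat) :
  log_jet (falling ((N + m)%:R + 'X) m) ((N + m) ^_ m)%:R
    (harmonic_number (N + m) - harmonic_number N).
Proof.
have -> : (N + m)%:R + 'X = (N%:R + 'X) + m%:R :> {poly rat} by rewrite natrD; ring.
rewrite falling_rising addrAC natr1; exact: log_jet_rising.
Qed.

Lemma ffactnD (N p q : nat) : N ^_ (p + q) = (N ^_ p * (N - p) ^_ q)%N.
Proof.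
elim: q => [|q IHq]; first by rewrite addn0 ffactn0 muln1.
by rewrite addnS !ffactnSr IHq mulnA subnDA.
Qed.

Lemma ffact_natE (N m : nat) : (N ^_ m)%:R = 'C(N, m)%:R * (m`!)%:R :> rat.
Proof. by rewrite -natrM bin_ffact. Qed.

Lemma ffact_neq0 (N m : nat) : ((N + m) ^_ m)%:R != 0 :> rat.
Proof. by rewrite Num.Theory.pnatr_eq0 -lt0n ffact_gt0 leq_addl. Qed.

Lemma bin_neq0 (N m : nat) : 'C(N + m, m)%:R != 0 :> rat.
Proof. by rewrite Num.Theory.pnatr_eq0 -lt0n bin_gt0 leq_addl. Qed.

(** The value is the wanted summand times a product independent of [k]; the logarithmic derivative
    is the wanted harmonic difference plus a constant independent of [k]. Both can therefore be
    pulled out of the sum. *)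
Lemma log_jet_term (n b c d k : nat) : (k <= n)%N ->
  log_jet
    (saalschutz_term ((c + b + d + n).+1%:R + 'X) b%:R c.+1%:R n k)
    ('C(n, k)%:R * 'C(c + b + d + n + k, k)%:R * 'C(b, k)%:R
      / ('C(c + k, k)%:R * 'C(d + k, k)%:R)
      * (((c + n) ^_ n)%:R * ((d + n) ^_ n)%:R))
    ((harmonic_number (c + b + d + n + k) - harmonic_number (d + k))
     + (harmonic_number (d + n) - harmonic_number (c + b + d + n))).
Proof.
move=> lekn; have [q defn] : exists q, n = (k + q)%N by exists (n - k)%N; lia.
have -> : 'C(n, k)%:R * 'C(c + b + d + n + k, k)%:R * 'C(b, k)%:R
      / ('C(c + k, k)%:R * 'C(d + k, k)%:R)
      * (((c + n) ^_ n)%:R * ((d + n) ^_ n)%:R)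
   = 'C(n, k)%:R * (((c + b + d + n + k) ^_ k)%:R * (b ^_ k)%:R
       * ((c + n) ^_ q)%:R * ((d + n) ^_ q)%:R) :> rat.
  (* The last [k] factors of each normalizing product cancel the binomials in the denominator. *)
  have splitE (N : nat) : ((N + n) ^_ n)%:R
      = ((N + n) ^_ q)%:R * ((N + k) ^_ k)%:R :> rat.
    rewrite -natrM; congr (_%:R); rewrite {2}defn (addnC k) ffactnD.
    by congr (_ * _ ^_ _)%N; lia.
  rewrite !splitE !(ffact_natE _ k).
  by field; rewrite !bin_neq0.
(* One summand per factor of [saalschutz_term], in order; the zeros belong to the three factors free
   of ['X]. *)
have -> : (harmonic_number (c + b + d + n + k) - harmonic_number (d + k))
     + (harmonic_number (d + n) - harmonic_number (c + b + d + n))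
   = 0 + ((harmonic_number (c + b + d + n + k) - harmonic_number (c + b + d + n))
       + 0 + 0 + (harmonic_number (d + n) - harmonic_number (d + k))).
  by ring.
rewrite /saalschutz_term -(polyC_natr _ 'C(_, _)).
apply: log_jetM; first exact: log_jetC.
apply: log_jetM; last first.
  have -> : (n - k = q)%N by lia.
  have -> : (c + b + d + n).+1%:R + 'X - c.+1%:R - b%:R
      = (d + k + q)%:R + 'X :> {poly rat}.
    by rewrite defn -!natr1 !natrD; ring.
  have -> : (d + n = d + k + q)%N by lia.
  exact: log_jet_falling.
apply: log_jetM; last first.
  have -> : c.+1%:R + k%:R = (c + k).+1%:R :> {poly rat} by rewrite -natrD addSn.
  rewrite rising_nat -polyC_natr; have -> : (c + k + (n - k) = c + n)%N by lia.
  have -> : (n - k = q)%N by lia.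
  exact: log_jetC.
apply: log_jetM; first exact: log_jet_rising.
rewrite falling_nat -polyC_natr; exact: log_jetC.
Qed.

(** Compares values and derivatives at 0 in [saalschutz] with first parameter
    [c + b + d + n + 1 + 'X]. *)
Lemma harmonic_saalschutz (n b c d : nat) :
  \sum_(k < n.+1)
    ('C(n, k)%:R * 'C(c + b + d + n + k, k)%:R * 'C(b, k)%:R)
    / ('C(c + k, k)%:R * 'C(d + k, k)%:R)
    * (harmonic_number (c + b + d + n + k) - harmonic_number (d + k))
  = ('C(b + d + n, n)%:R * 'C(c + b + n, n)%:R)
    / ('C(c + n, n)%:R * 'C(d + n, n)%:R)
    * (harmonic_number (b + d + n) - harmonic_number (b + d)
       + harmonic_number (c + b + d + n) - harmonic_number (d + n)) :> rat.
Proof.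
set l := (c + b + d + n)%N.
pose D : rat := ((c + n) ^_ n)%:R * ((d + n) ^_ n)%:R.
pose F : rat := ((b + d + n) ^_ n)%:R * ((c + b + n) ^_ n)%:R.
pose h := harmonic_number (d + n) - harmonic_number l.
have D0 : D != 0 by rewrite mulf_neq0 ?ffact_neq0.
have FE : 'C(b + d + n, n)%:R * 'C(c + b + n, n)%:R
    / ('C(c + n, n)%:R * 'C(d + n, n)%:R) = F / D.
  have fact0 : (n`!)%:R != 0 :> rat by rewrite Num.Theory.pnatr_eq0 -lt0n fact_gt0.
  by rewrite /F /D !ffact_natE; field; rewrite fact0 !bin_neq0.
have jetL (k : 'I_n.+1) := log_jet_term n b c d k (ltn_ord k).
have [] : log_jet (falling (l.+1%:R + 'X - c.+1%:R) n * rising (c.+1%:R + b%:R) n)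
    F (harmonic_number (b + d + n) - harmonic_number (b + d) + 0).
  apply: log_jetM.
    have -> : l.+1%:R + 'X - c.+1%:R = (b + d + n)%:R + 'X :> {poly rat}.
      by rewrite -!natr1 !natrD; ring.
    exact: log_jet_falling.
  by rewrite -natrD addSn rising_nat -polyC_natr; apply: log_jetC.
rewrite -saalschutz horner_sum linear_sum horner_sum.
under eq_bigr => k _ do rewrite (proj1 (jetL k)).
rewrite -big_distrl -/l -/D => /= sumT.
under eq_bigr => k _ do rewrite (proj2 (jetL k)) mulrAC mulrDr mulrDl.
rewrite big_split /= -!big_distrl -/l -/D -/h /= => sumH.
rewrite FE; clearbody D F; apply: (mulIf D0).
(* Subtracting [h] times the value identity [sumT] from the derivative identity [sumH] removes the
   constant [h] from the sum and yields the last two harmonic numbers. *)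
transitivity (F * (harmonic_number (b + d + n) - harmonic_number (b + d) + 0) - F * h).
  by rewrite -sumH -sumT; ring.
by rewrite /h; field.
Qed.

(* The subtractions are in nat; under the hypothesis none of them truncates. *)
Theorem theorem2 (n lam mu nu : nat) (hlam : (1 + mu + nu < lam)%N) :
  \sum_(0 <= k < n.+1)
    ('C(n, k)%:R * 'C(lam * n + k, k)%:R * 'C(mu * n + n, k)%:R)
    / ('C(nu * n + k, k)%:R * 'C((lam - mu - nu - 2) * n + k, k)%:R)
    * (harmonic_number (lam * n + k)
       - harmonic_number ((lam - mu - nu - 2) * n + k))
  = ('C((lam - nu) * n, n)%:R * 'C((mu + nu + 2) * n, n)%:R)
    / ('C(nu * n + n, n)%:R * 'C((lam - mu - nu - 1) * n, n)%:R)
    * (harmonic_number ((lam - nu) * n)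
       - harmonic_number ((lam - nu - 1) * n)
       + harmonic_number (lam * n)
       - harmonic_number ((lam - mu - nu - 1) * n)) :> rat.
Proof.
rewrite big_mkord.
(* [hlam] makes [g = lam - mu - nu - 2] a genuine difference, so [lam * n] is the sum of [nu * n],
   [mu * n + n], [g * n] and [n], as [harmonic_saalschutz] requires. *)
have [g ->] : exists g, lam = (nu + (mu + 1) + g + 1)%N.
  by exists (lam - mu - nu - 2)%N; lia.
have := harmonic_saalschutz n (mu * n + n) (nu * n) (g * n).
have -> : (nu * n + (mu * n + n) + g * n + n = (nu + (mu + 1) + g + 1) * n)%N by lia.
have -> : (mu * n + n + g * n + n = (nu + (mu + 1) + g + 1 - nu) * n)%N by nia.
have -> : (mu * n + n + g * n = (nu + (mu + 1) + g + 1 - nu - 1) * n)%N by nia.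
have -> : (nu * n + (mu * n + n) + n = (mu + nu + 2) * n)%N by lia.
have -> : (g * n + n = (nu + (mu + 1) + g + 1 - mu - nu - 1) * n)%N by nia.
by have -> : (nu + (mu + 1) + g + 1 - mu - nu - 2 = g)%N by lia.
Qed.
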